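(* Let $\alpha\in\mathbb{N}_0$, $\lambda\in\mathbb{R}$ and $x_1,x_2\in\mathbb{R}$. For every integer $n\ge0$, the degenerate Fubini-type polynomials satisfy $$a_{n+1}^{(\alpha)}(x_1+x_2+\lambda;\lambda)=(x_1+x_2+\lambda)\,a_n^{(\alpha)}(x_1+x_2;\lambda)+\sqrt{2}\,\alpha\,a_n^{(\alpha+1/2)}(x_1+x_2+1;\lambda).$$ Consequently, for every $y\in\mathbb{R}$ and every integer $n\ge0$, the Fubini-type polynomials satisfy $$a_{n+1}^{(\alpha)}(y)=y\,a_n^{(\alpha)}(y)+\sqrt{2}\,\alpha\,a_n^{(\alpha+1/2)}(y+1).$$
   Context: For an order $\beta$ with $2\beta\in\mathbb{Z}$, the degenerate Fubini-type polynomials $a_n^{(\beta)}(x;\lambda)$ are defined by the power series expansion in $t$ near $t=0$ $$\frac{2^{\beta}}{\left(2-(1+\lambda t)^{1/\lambda}\right)^{2\beta}}(1+\lambda t)^{x/\lambda}=\sum_{n=0}^{\infty}a_n^{(\beta)}(x;\lambda)\frac{t^n}{n!},$$ where for $\lambda\neq0$, $(1+\lambda t)^{y/\lambda}$ is the principal power, and for $\lambda=0$ it is understood as its limit $e^{yt}$. The Fubini-type polynomials $a_n^{(\beta)}(x)$ are defined by $$\frac{2^{\beta}}{(2-e^{t})^{2\beta}}e^{xt}=\sum_{n=0}^{\infty}a_n^{(\beta)}(x)\frac{t^n}{n!},\qquad |t|<\log 2.$$ *)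

(* Defs.v *)
From Stdlib Require Import Reals Factorial ClassicalEpsilon.
From Coquelicot Require Import Coquelicot.
Open Scope R_scope.

(* (1 + lambda t)^(y / lambda), read as its limit e^(y t) at lambda = 0.
   [Rpower] is the principal power only on a positive base, so the second
   branch is meaningful for 1 + lambda t > 0, in particular near t = 0. *)
Definition degen_exp (lambda y t : R) : R :=
  if Req_EM_T lambda 0 then exp (y * t) else Rpower (1 + lambda * t) (y / lambda).

(* The exponent 2 beta is a real number here. Where the expansions below are
   required, the base is positive, so for 2 beta an integer [Rpower] is the
   usual integer power. *)
Definition degen_fubini_gf (beta x lambda t : R) : R :=
  Rpower 2 beta / Rpower (2 - degen_exp lambda 1 t) (2 * beta)
  * degen_exp lambda x t.

Definition fubini_gf (beta x t : R) : R :=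
  Rpower 2 beta / Rpower (2 - exp t) (2 * beta) * exp (x * t).

Definition egf_expansion_at (a : nat -> R) (G : R -> R) (t : R) : Prop :=
  is_pseries (fun n => a n / INR (fact n)) t (G t).

Definition degen_fubini_spec (beta x lambda : R) (a : nat -> R) : Prop :=
  locally 0 (egf_expansion_at a (degen_fubini_gf beta x lambda)).

Definition fubini_spec (beta x : R) (a : nat -> R) : Prop :=
  forall t : R, Rabs t < ln 2 -> egf_expansion_at a (fubini_gf beta x) t.

(* [degen_fubini beta x lambda n] is a_n^(beta)(x; lambda): the sequence
   selected by the defining expansion. A power series is determined by its
   sum near 0, so at most one sequence satisfies the specification; one
   exists because the generating function is analytic at 0. *)
Definition degen_fubini (beta x lambda : R) : nat -> R :=
  epsilon (inhabits (fun _ : nat => 0)) (degen_fubini_spec beta x lambda).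

(* [fubini beta x n] is a_n^(beta)(x). The singularity of the generating
   function nearest to 0 is ln 2. *)
Definition fubini (beta x : R) : nat -> R :=
  epsilon (inhabits (fun _ : nat => 0)) (fubini_spec beta x).

(* Main.v *)
(* Write E_y(t) = (1 + lambda t)^(y/lambda), so that E_y' = y E_(y - lambda) and
   E_y E_z = E_(y + z). Differentiating 2^beta (2 - E_1)^(-2 beta) E_(x + lambda)
   gives (x + lambda) 2^beta (2 - E_1)^(-2 beta) E_x plus
   2 beta 2^beta (2 - E_1)^(-2 beta - 1) E_(x + 1), and
   2 * 2^beta = sqrt 2 * 2^(beta + 1/2); the recurrence compares coefficients.
   The selected sequences satisfy their specifications only once the expansions
   are known to exist: if u_0 = 1 and sum_(k >= 1) |u_k| r^k <= 1, the
   reciprocal of sum u_k t^k has coefficients bounded by r^(-n). The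
   non-degenerate case is lambda = 0. *)
Require Import Defs.
From Stdlib Require Import Reals Lra Lia Wf_nat Factorial ClassicalEpsilon.
From Coquelicot Require Import Coquelicot.
Open Scope R_scope.

(** * Power series expansions on a disk around 0 *)

(** The radius is explicit, since [fubini_spec] asks for the whole disk [Rabs t < ln 2] and not just
    some neighbourhood of 0. *)
Definition expands (r : R) (f : R -> R) (a : nat -> R) : Prop :=
  forall t : R, Rabs t < r -> is_pseries a t (f t).

Lemma pseries_lim_0 (a : nat -> R) (t l : R) :
  is_pseries a t l -> is_lim_seq (fun n => a n * t ^ n) 0.
Proof.
  intros H.
  apply is_lim_seq_ext with (fun n => scal (pow_n t n) (a n)).
  - intros n. rewrite pow_n_pow. unfold scal; simpl; unfold mult; simpl. ring.
  - apply ex_series_lim_0. exists l. exact H.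
Qed.

(** Strictness comes from a point [s] between [Rabs t] and [r]: the terms of the series converging
    at [s] tend to 0, which fails beyond the radius of convergence. *)
Lemma expands_radius (r : R) (f : R -> R) (a : nat -> R) (t : R) :
  expands r f a -> Rabs t < r -> Rbar_lt (Rabs t) (CV_radius a).
Proof.
  intros H Ht. apply Rbar_not_le_lt. intros Hle.
  set (s := (Rabs t + r) / 2).
  assert (Hs : Rabs s = s).
  { apply Rabs_pos_eq. unfold s. pose proof (Rabs_pos t). lra. }
  apply (CV_disk_outside a s).
  - apply Rbar_le_lt_trans with (Rabs t); [exact Hle|].
    rewrite Hs. simpl. unfold s. lra.
  - apply (pseries_lim_0 a s (f s)), H. rewrite Hs. unfold s. lra.
Qed.

Lemma expands_le (r s : R) (f : R -> R) (a : nat -> R) :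
  s <= r -> expands r f a -> expands s f a.
Proof. intros Hs H t Ht. apply H. lra. Qed.

Lemma expands_locally (r : R) (f : R -> R) (a : nat -> R) :
  0 < r -> expands r f a -> locally 0 (fun t => is_pseries a t (f t)).
Proof.
  intros Hr H. exists (mkposreal r Hr). intros t Ht. apply H.
  change (Rabs (t - 0) < r) in Ht. now rewrite Rminus_0_r in Ht.
Qed.

Lemma locally_expands (f : R -> R) (a : nat -> R) :
  locally 0 (fun t => is_pseries a t (f t)) -> exists r, 0 < r /\ expands r f a.
Proof.
  intros [r Hr]. exists r. split; [apply cond_pos|].
  intros t Ht. apply Hr. change (Rabs (t - 0) < r). now rewrite Rminus_0_r.
Qed.

Lemma radius_pos (f : R -> R) (a : nat -> R) :
  locally 0 (fun t => is_pseries a t (f t)) -> Rbar_lt 0 (CV_radius a).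
Proof.
  intros H. destruct (locally_expands f a H) as [r [Hr Ha]].
  rewrite <- Rabs_R0. apply (expands_radius r f); [exact Ha|]. now rewrite Rabs_R0.
Qed.

Lemma pseries_locally_unique (f g : R -> R) (a b : nat -> R) (n : nat) :
  locally 0 (fun t => is_pseries a t (f t)) ->
  locally 0 (fun t => is_pseries b t (g t)) ->
  locally 0 (fun t => f t = g t) -> a n = b n.
Proof.
  intros Ha Hb Hfg. apply PSeries_ext_recip.
  - exact (radius_pos f a Ha).
  - exact (radius_pos g b Hb).
  - generalize (filter_and _ _ Ha (filter_and _ _ Hb Hfg)).
    apply filter_imp. intros t [H1 [H2 H3]].
    rewrite (is_pseries_unique _ _ _ H1), (is_pseries_unique _ _ _ H2). exact H3.
Qed.

Lemma expands_mult (r : R) (f g : R -> R) (a b : nat -> R) :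
  expands r f a -> expands r g b ->
  expands r (fun t => f t * g t) (PS_mult a b).
Proof.
  intros Ha Hb t Ht. apply is_pseries_mult; auto.
  - exact (expands_radius r f a t Ha Ht).
  - exact (expands_radius r g b t Hb Ht).
Qed.

Lemma is_pseries_one (t : R) :
  is_pseries (fun n => match n with O => 1 | S _ => 0 end) t 1.
Proof.
  assert (H0 : is_pseries (fun _ => 0) t 0).
  { pose proof (PSeries_correct (fun _ => 0) t) as H.
    rewrite PSeries_const_0 in H. apply H, CV_radius_inside.
    now rewrite CV_radius_const_0. }
  (* Without its leading term the series is the zero series, with sum 1 - 1 = 0. *)
  apply is_series_decr_1.
  match goal with |- is_series _ ?x => replace x with 0 end.
  - eapply is_series_ext; [|exact H0]. intros n.
    unfold scal; simpl; unfold mult; simpl. now rewrite !Rmult_0_r.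
  - unfold plus, opp, scal; simpl. unfold mult, one; simpl. ring.
Qed.

Lemma is_pseries_lin_comb (c d t la lb : R) (a b : nat -> R) :
  is_pseries a t la -> is_pseries b t lb ->
  is_pseries (fun n => c * a n + d * b n) t (c * la + d * lb).
Proof.
  intros Ha Hb.
  exact (is_pseries_plus _ _ _ _ _
           (is_pseries_scal c _ _ _ (Rmult_comm _ _) Ha)
           (is_pseries_scal d _ _ _ (Rmult_comm _ _) Hb)).
Qed.

Lemma expands_pow (r : R) (f : R -> R) (a : nat -> R) (m : nat) :
  expands r f a -> exists b, expands r (fun t => f t ^ m) b.
Proof.
  intros Ha. induction m as [|m [b Hb]].
  - eexists. intros t _. apply is_pseries_one.
  - exists (PS_mult a b). exact (expands_mult r _ _ a b Ha Hb).
Qed.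

(** * Reciprocal of a power series *)

(* Course-of-values recursion: [inv_coef_upto u n k] is the k-th coefficient of
   the reciprocal of [sum u_j t^j] only for [k <= n]; it assumes [u 0 = 1]. *)
Fixpoint inv_coef_upto (u : nat -> R) (n : nat) : nat -> R :=
  match n with
  | O => fun _ => 1
  | S m => fun k =>
      if (k <=? m)%nat then inv_coef_upto u m k
      else - sum_f_R0 (fun j => u (S j) * inv_coef_upto u m (m - j)) m
  end.

Definition inv_coef (u : nat -> R) (n : nat) : R := inv_coef_upto u n n.

Lemma inv_coef_upto_eq (u : nat -> R) (n k : nat) :
  (k <= n)%nat -> inv_coef_upto u n k = inv_coef u k.
Proof.
  induction n as [|n IH]; intros Hk.
  - now replace k with O by lia.
  - destruct (Nat.eq_dec k (S n)) as [->|Hne]; [reflexivity|].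
    simpl. replace (k <=? n)%nat with true by (symmetry; apply Nat.leb_le; lia).
    apply IH. lia.
Qed.

Lemma inv_coef_S (u : nat -> R) (n : nat) :
  inv_coef u (S n) = - sum_f_R0 (fun j => u (S j) * inv_coef u (n - j)) n.
Proof.
  unfold inv_coef at 1. cbn [inv_coef_upto].
  replace (S n <=? n)%nat with false by (symmetry; apply Nat.leb_gt; lia).
  f_equal. apply sum_eq. intros j Hj. f_equal. apply inv_coef_upto_eq. lia.
Qed.

(** Strong induction. Splitting r^(n+1) as r^(j+1) r^(n-j) in the recursion, the factors |v_(n-j)|
    r^(n-j) are at most 1, and what remains is a partial sum of |u_(j+1)| r^(j+1). *)
Lemma inv_coef_bound (u : nat -> R) (r : R) (n : nat) :
  0 < r ->
  (forall m, sum_f_R0 (fun k => Rabs (u (S k)) * r ^ S k) m <= 1) ->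
  Rabs (inv_coef u n) * r ^ n <= 1.
Proof.
  intros Hr Hu. induction n as [n IH] using lt_wf_ind. destruct n as [|n].
  - unfold inv_coef. simpl. rewrite Rabs_R1. lra.
  - rewrite inv_coef_S, Rabs_Ropp.
    apply Rle_trans with (2 := Hu n).
    apply Rle_trans
      with (sum_f_R0 (fun j => Rabs (u (S j) * inv_coef u (n - j))) n * r ^ S n).
    + apply Rmult_le_compat_r; [apply pow_le; lra|]. apply Rsum_abs.
    + rewrite Rmult_comm, scal_sum. apply sum_Rle. intros j Hj.
      rewrite Rabs_mult.
      replace (r ^ S n) with (r ^ S j * r ^ (n - j))
        by (rewrite <- pow_add; f_equal; lia).
      pose proof (IH (n - j)%nat ltac:(lia)).
      assert (0 <= Rabs (u (S j)) * r ^ S j)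
        by (apply Rmult_le_pos; [apply Rabs_pos | apply pow_le; lra]).
      replace (Rabs (u (S j)) * Rabs (inv_coef u (n - j)) * (r ^ S j * r ^ (n - j)))
        with ((Rabs (u (S j)) * r ^ S j) * (Rabs (inv_coef u (n - j)) * r ^ (n - j)))
        by ring.
      nra.
Qed.

Lemma expands_of_bound (r M : R) (a : nat -> R) :
  0 < r -> (forall n, Rabs (a n) * r ^ n <= M) -> expands r (PSeries a) a.
Proof.
  intros Hr Ha t Ht. apply PSeries_correct, CV_radius_inside.
  apply Rbar_lt_le_trans with r; [exact Ht|].
  apply (CV_radius_bounded a). exists M. intros n.
  rewrite Rabs_mult, (Rabs_pos_eq (r ^ n)) by (apply pow_le; lra). apply Ha.
Qed.

Lemma expands_inv (r : R) (f : R -> R) (u : nat -> R) :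
  0 < r -> u O = 1 ->
  (forall m, sum_f_R0 (fun k => Rabs (u (S k)) * r ^ S k) m <= 1) ->
  expands r f u -> exists b, expands r (fun t => / f t) b.
Proof.
  intros Hr Hu0 Hu Hf. exists (inv_coef u).
  assert (Hb : expands r (PSeries (inv_coef u)) (inv_coef u)).
  { apply (expands_of_bound r 1); auto. intros n. now apply inv_coef_bound. }
  intros t Ht.
  (* The recursion makes the Cauchy product of [u] and [inv_coef u] equal to 1, 0, 0, ...; this
     identity also yields f t <> 0 below. *)
  assert (H1 : f t * PSeries (inv_coef u) t = 1).
  { pose proof (expands_mult r _ _ _ _ Hf Hb t Ht) as H.
    apply is_pseries_unique in H. rewrite <- H.
    rewrite <- (is_pseries_unique _ _ _ (is_pseries_one t)).
    apply PSeries_ext. intros [|n]; unfold PS_mult.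
    - simpl. rewrite Hu0. unfold inv_coef. simpl. ring.
    - rewrite decomp_sum by lia. rewrite Hu0, Nat.sub_0_r, inv_coef_S. simpl. ring. }
  replace (/ f t) with (PSeries (inv_coef u) t); [now apply Hb|].
  assert (f t <> 0) by (intros H; rewrite H in H1; lra).
  now apply Rmult_eq_reg_l with (f t); [rewrite H1, Rinv_r|].
Qed.

(** * Exponentials and the binomial series *)

Lemma expands_exp (r x : R) :
  expands r (fun t => exp (x * t)) (fun n => x ^ n / INR (fact n)).
Proof.
  intros t _. pose proof (is_exp_Reals (x * t)) as H.
  unfold is_pseries in *. eapply is_series_ext; [|exact H].
  intros n. simpl. rewrite !pow_n_pow. unfold scal; simpl; unfold mult; simpl.
  rewrite (pow_n_pow t), Rpow_mult_distr. unfold Rdiv. ring.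
Qed.

Lemma degen_exp_0 (lambda y : R) : degen_exp lambda y 0 = 1.
Proof.
  unfold degen_exp. destruct (Req_EM_T lambda 0).
  - now rewrite Rmult_0_r, exp_0.
  - unfold Rpower. now rewrite Rmult_0_r, Rplus_0_r, ln_1, Rmult_0_r, exp_0.
Qed.

Lemma degen_exp_plus (lambda y z t : R) :
  degen_exp lambda (y + z) t = degen_exp lambda y t * degen_exp lambda z t.
Proof.
  unfold degen_exp. destruct (Req_EM_T lambda 0).
  - rewrite <- exp_plus. f_equal. ring.
  - rewrite <- Rpower_plus. f_equal. now field.
Qed.

Lemma degen_exp_pos (lambda y t : R) : 0 < degen_exp lambda y t.
Proof.
  unfold degen_exp. destruct (Req_EM_T lambda 0); apply exp_pos.
Qed.

(** Lets a factor 1 + lambda t be absorbed as a shift of the exponent by lambda, uniformly in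
    lambda. *)
Lemma degen_exp_step (lambda t : R) :
  0 < 1 + lambda * t -> degen_exp lambda lambda t = 1 + lambda * t.
Proof.
  intros H. unfold degen_exp. destruct (Req_EM_T lambda 0) as [->|Hl].
  - now rewrite Rmult_0_l, exp_0, Rplus_0_r.
  - unfold Rdiv. rewrite Rinv_r by exact Hl. now apply Rpower_1.
Qed.

Lemma is_derive_degen_exp (lambda y t : R) :
  0 < 1 + lambda * t ->
  is_derive (degen_exp lambda y) t (y * degen_exp lambda (y - lambda) t).
Proof.
  intros H.
  (* In the form y E_y / (1 + lambda t) the derivative can be checked directly in both branches of
     [degen_exp]. *)
  assert (Hs : degen_exp lambda (y - lambda) t = degen_exp lambda y t / (1 + lambda * t)).
  { replace (degen_exp lambda y t) with
      (degen_exp lambda (y - lambda) t * degen_exp lambda lambda t)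
      by (rewrite <- degen_exp_plus; f_equal; ring).
    rewrite degen_exp_step by exact H. field. lra. }
  rewrite Hs. unfold degen_exp. destruct (Req_EM_T lambda 0) as [->|Hl].
  - auto_derive; [exact I|]. field.
  - unfold Rpower. auto_derive; [exact H|]. field. lra.
Qed.

(** The degenerate falling factorial y (y - lambda) ... (y - (n-1) lambda) divided by n!; at lambda
    = 0 it is y^n / n!. *)
Fixpoint degen_exp_coef (lambda y : R) (n : nat) : R :=
  match n with
  | O => 1
  | S m => degen_exp_coef lambda y m * (y - INR m * lambda) / INR (S m)
  end.

(** Since |y - n lambda| <= (n+1) M, each step of the recursion multiplies by at most M in absolute
    value. *)
Lemma degen_exp_coef_bound (lambda y M : R) (n : nat) :
  Rabs y + Rabs lambda <= M -> Rabs (degen_exp_coef lambda y n) <= M ^ n.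
Proof.
  intros HM. induction n as [|n IH].
  - simpl. rewrite Rabs_R1. lra.
  - cbn [degen_exp_coef pow].
    pose proof (Rabs_pos y). pose proof (Rabs_pos lambda). pose proof (pos_INR n).
    assert (Hn : 0 < INR (S n)) by (apply lt_0_INR; lia).
    unfold Rdiv. rewrite !Rabs_mult, Rabs_inv, (Rabs_pos_eq (INR (S n))) by lra.
    assert (Hq : Rabs (y - INR n * lambda) * / INR (S n) <= M).
    { apply Rmult_le_reg_r with (INR (S n)); [exact Hn|].
      rewrite Rmult_assoc, Rinv_l, Rmult_1_r by lra.
      unfold Rminus. eapply Rle_trans; [apply Rabs_triang|].
      rewrite Rabs_Ropp, Rabs_mult, (Rabs_pos_eq (INR n)) by assumption.
      rewrite S_INR. nra. }
    rewrite Rmult_assoc, (Rmult_comm M).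
    apply Rmult_le_compat; auto using Rabs_pos.
    apply Rmult_le_pos; [apply Rabs_pos|].
    apply Rlt_le, Rinv_0_lt_compat, Hn.
Qed.

Lemma constant_of_derive_0 (r t : R) (g : R -> R) :
  (forall s, Rabs s < r -> is_derive g s 0) -> Rabs t < r -> g t = g 0.
Proof.
  intros Hg Ht. destruct (Rtotal_order t 0) as [Hlt|[->|Hgt]]; [|reflexivity|].
  - apply (eq_is_derive g t 0); [|exact Hlt].
    intros s Hs. apply Hg. apply Rabs_def2 in Ht. apply Rabs_def1; lra.
  - symmetry. apply (eq_is_derive g 0 t); [|exact Hgt].
    intros s Hs. apply Hg. apply Rabs_def2 in Ht. apply Rabs_def1; lra.
Qed.

(* The series and the function satisfy the same equation
   (1 + lambda t) f' = y f with f 0 = 1. *)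
Lemma expands_degen_exp (lambda y M : R) :
  0 < M -> Rabs y + Rabs lambda <= M ->
  expands (/ M) (degen_exp lambda y) (degen_exp_coef lambda y).
Proof.
  intros HM0 HM. set (p := degen_exp_coef lambda y).
  assert (Hr : 0 < / M) by now apply Rinv_0_lt_compat.
  assert (Hp : expands (/ M) (PSeries p) p).
  { apply (expands_of_bound (/ M) 1); [exact Hr|]. intros n.
    apply Rle_trans with (M ^ n * (/ M) ^ n).
    - apply Rmult_le_compat_r; [apply pow_le; lra|]. now apply degen_exp_coef_bound.
    - rewrite <- Rpow_mult_distr, Rinv_r, pow1 by lra. lra. }
  assert (Hbase : forall t, Rabs t < / M -> 0 < 1 + lambda * t).
  { intros t Ht. assert (Hlt : Rabs (lambda * t) < 1).
    { rewrite Rabs_mult.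
      assert (Rabs t * M < 1).
      { rewrite <- (Rinv_l M) by lra. now apply Rmult_lt_compat_r. }
      pose proof (Rabs_pos t). pose proof (Rabs_pos y). nra. }
    apply Rabs_def2 in Hlt. lra. }
  (* On coefficients the equation reads (n+1) p_(n+1) + lambda n p_n = y p_n, which is the recursion
     of [degen_exp_coef]. *)
  assert (Hode : forall t, Rabs t < / M ->
            (1 + lambda * t) * PSeries (PS_derive p) t = y * PSeries p t).
  { intros t Ht.
    assert (Hd : is_pseries (PS_derive p) t (PSeries (PS_derive p) t)).
    { apply PSeries_correct, ex_pseries_derive.
      exact (expands_radius _ _ _ _ Hp Ht). }
    pose proof (is_pseries_plus _ _ _ _ _ Hd
      (is_pseries_scal lambda _ _ _ (Rmult_comm _ _) (is_pseries_incr_1 _ _ _ Hd))) as H1.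
    apply is_pseries_unique in H1.
    transitivity (PSeries (PS_plus (PS_derive p)
                    (PS_scal lambda (PS_incr_1 (PS_derive p)))) t).
    - rewrite H1. unfold plus, scal; simpl; unfold mult; simpl. ring.
    - rewrite <- PSeries_scal. apply PSeries_ext. intros n.
      unfold PS_plus, PS_scal, PS_incr_1, PS_derive, plus, scal; simpl; unfold mult; simpl.
      assert (Hs : forall k, INR (S k) * p (S k) = p k * (y - INR k * lambda)).
      { intros k. unfold p. cbn [degen_exp_coef]. field. apply not_0_INR. lia. }
      change (match n with O => 1 | S _ => INR n + 1 end) with (INR (S n)).
      (* At n = 0 the leading zero of [PS_incr_1] matches the vanishing term 0 * lambda. *)
      rewrite Hs. destruct n as [|n].
      + unfold zero; simpl. ring.
      + change (match n with O => 1 | S _ => INR n + 1 end) with (INR (S n)). ring. }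
  intros t Ht.
  replace (degen_exp lambda y t) with (PSeries p t); [now apply Hp|].
  (* Uniqueness for the differential equation: the product with E_(-y) has zero derivative, hence
     keeps its value 1 at 0. Cancelling E_(-y) > 0 against E_y E_(-y) = 1 then identifies the series
     with E_y. *)
  assert (Hc : PSeries p t * degen_exp lambda (- y) t = 1).
  { rewrite (constant_of_derive_0 (/ M) t (fun s => PSeries p s * degen_exp lambda (- y) s)).
    - rewrite degen_exp_0, PSeries_0. unfold p. simpl. ring.
    - intros s Hs.
      assert (Hpos : 0 < 1 + lambda * s) by now apply Hbase.
      replace 0 with
        (PSeries (PS_derive p) s * degen_exp lambda (- y) s +
         PSeries p s * (- y * degen_exp lambda (- y - lambda) s)).
      + apply (is_derive_mult (PSeries p) (degen_exp lambda (- y))).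
        * apply is_derive_PSeries. exact (expands_radius _ _ _ _ Hp Hs).
        * now apply is_derive_degen_exp.
        * intros; apply Rmult_comm.
      + replace (degen_exp lambda (- y) s) with
          (degen_exp lambda (- y - lambda) s * degen_exp lambda lambda s)
          by (rewrite <- degen_exp_plus; f_equal; ring).
        rewrite degen_exp_step by exact Hpos.
        transitivity (degen_exp lambda (- y - lambda) s *
          ((1 + lambda * s) * PSeries (PS_derive p) s - y * PSeries p s)); [ring|].
        rewrite (Hode s Hs). ring.
    - exact Ht. }
  apply Rmult_eq_reg_r with (degen_exp lambda (- y) t).
  - rewrite Hc, <- degen_exp_plus, Rplus_opp_r.
    unfold degen_exp. destruct (Req_EM_T lambda 0).
    + now rewrite Rmult_0_l, exp_0.
    + unfold Rdiv. rewrite Rmult_0_l. symmetry. apply Rpower_O. now apply Hbase.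
  - pose proof (degen_exp_pos lambda (- y) t). lra.
Qed.

(** * Existence of the expansions *)

(** Serves both the degenerate and the classical case. As p_0 = 1, the series of 2 - f starts with 1
    and continues with -p_k, so the bound on [p] is the one that [expands_inv] requires. Positivity
    of 2 - f turns [Rpower] into an m-th power. *)
Lemma expands_generating_function (r c : R) (m : nat) (f g : R -> R) (p q : nat -> R) :
  0 < r -> p O = 1 ->
  (forall n, sum_f_R0 (fun k => Rabs (p (S k)) * r ^ S k) n <= 1) ->
  expands r f p -> expands r g q -> (forall t, Rabs t < r -> f t < 2) ->
  exists a, expands r (fun t => c / Rpower (2 - f t) (INR m) * g t) a.
Proof.
  intros Hr Hp0 Hp Hf Hg Hlt.
  destruct (expands_inv r (fun t => 2 - f t)
    (fun n => 2 * match n with O => 1 | S _ => 0 end + -1 * p n)) as [b Hb];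
    [exact Hr| | | |].
  - rewrite Hp0. ring.
  - intros n. eapply Rle_trans; [|apply (Hp n)]. right. apply sum_eq. intros k _.
    f_equal. rewrite <- Rabs_Ropp. f_equal. ring.
  - intros t Ht. replace (2 - f t) with (2 * 1 + -1 * f t) by ring.
    apply is_pseries_lin_comb; [apply is_pseries_one | now apply Hf].
  - destruct (expands_pow r _ b m Hb) as [d Hd].
    exists (PS_scal c (PS_mult d q)). intros t Ht.
    rewrite Rpower_pow by (specialize (Hlt t Ht); lra).
    replace (c / (2 - f t) ^ m * g t) with (c * ((/ (2 - f t)) ^ m * g t))
      by (rewrite pow_inv; unfold Rdiv; ring).
    exact (is_pseries_scal c _ _ _ (Rmult_comm _ _)
             (expands_mult r _ _ _ _ Hd Hg t Ht)).
Qed.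

Lemma egf_expansion_exists (r : R) (f : R -> R) (a : nat -> R) :
  expands r f a ->
  exists b, forall t, Rabs t < r -> egf_expansion_at b f t.
Proof.
  intros Ha. exists (fun n => a n * INR (fact n)). intros t Ht. unfold egf_expansion_at.
  apply is_pseries_ext with a; [|now apply Ha].
  intros n. change (a n = a n * INR (fact n) / INR (fact n)). field. apply INR_fact_neq_0.
Qed.

(** With y = 1 and z = 2 this is the neighbourhood on which both 1 + lambda t and 2 - E_1(t) are
    positive. *)
Lemma degen_exp_near_0 (lambda y z : R) :
  1 < z -> locally 0 (fun t => 0 < 1 + lambda * t /\ degen_exp lambda y t < z).
Proof.
  intros Hz. apply filter_and.
  - apply (locally_open (fun t => 0 < 1 + lambda * t)); [|now auto|lra].
    apply (open_comp (fun t => 1 + lambda * t) (fun s => 0 < s)).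
    + intros t _. apply (ex_derive_continuous (fun t => 1 + lambda * t)).
      auto_derive. exact I.
    + apply open_gt.
  - assert (Hc : continuous (degen_exp lambda y) 0).
    { apply (ex_derive_continuous (degen_exp lambda y)). eexists.
      apply is_derive_degen_exp. lra. }
    apply (Hc (fun s => s < z)). rewrite degen_exp_0. now apply open_lt.
Qed.

Lemma degen_fubini_correct (beta x lambda : R) (m : nat) :
  2 * beta = INR m ->
  degen_fubini_spec beta x lambda (degen_fubini beta x lambda).
Proof.
  intros Hm. unfold degen_fubini. apply epsilon_spec.
  (* Dominates both 1 + |lambda| and |x| + |lambda|, so that E_1 and E_x expand on a common disk. *)
  set (M := 1 + Rabs x + Rabs lambda).
  pose proof (Rabs_pos x) as Hx. pose proof (Rabs_pos lambda) as Hl.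
  assert (HM : 0 < M) by (unfold M; lra).
  destruct (degen_exp_near_0 lambda 1 2) as [e He]; [lra|].
  (* The bound [e] keeps E_1 below 2; the bound 1/(2M) makes the k-th term of E_1 at most 2^(-k),
     and these sum to at most 1 over k >= 1. *)
  set (r := Rmin e (/ (2 * M))).
  assert (HiM : / (2 * M) = / 2 * / M) by (field; lra).
  assert (Hi : 0 < / M) by now apply Rinv_0_lt_compat.
  assert (Hr : 0 < r).
  { apply Rmin_glb_lt; [apply cond_pos | lra]. }
  assert (HrM : r <= / M).
  { eapply Rle_trans; [apply Rmin_r|]. lra. }
  assert (Hp : forall n,
    sum_f_R0 (fun k => Rabs (degen_exp_coef lambda 1 (S k)) * r ^ S k) n <= 1).
  { intros n. apply Rle_trans with (sum_f_R0 (fun k => (/ 2) ^ k * / 2) n).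
    - apply sum_Rle. intros k _.
      apply Rle_trans with (M ^ S k * (/ (2 * M)) ^ S k).
      + apply Rmult_le_compat; [apply Rabs_pos | apply pow_le; lra | |].
        * apply degen_exp_coef_bound. rewrite Rabs_R1. unfold M. lra.
        * apply pow_incr. split; [lra | apply Rmin_r].
      + rewrite <- Rpow_mult_distr. replace (M * / (2 * M)) with (/ 2) by (field; lra).
        simpl. lra.
    - rewrite <- scal_sum, tech3 by lra.
      pose proof (pow_lt (/ 2) (S n)). lra. }
  destruct (expands_generating_function r (Rpower 2 beta) m
              (degen_exp lambda 1) (degen_exp lambda x)
              (degen_exp_coef lambda 1) (degen_exp_coef lambda x)) as [a Ha]; auto.
  - apply expands_le with (/ M); [exact HrM|].
    apply expands_degen_exp; [exact HM|]. rewrite Rabs_R1. unfold M. lra.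
  - apply expands_le with (/ M); [exact HrM|].
    apply expands_degen_exp; [exact HM|]. unfold M. lra.
  - intros t Ht. apply He. change (Rabs (t - 0) < e). rewrite Rminus_0_r.
    eapply Rlt_le_trans; [exact Ht | apply Rmin_l].
  - rewrite <- Hm in Ha. destruct (egf_expansion_exists _ _ _ Ha) as [b Hb].
    exists b. exists (mkposreal r Hr). intros t Ht.
    change (Rabs (t - 0) < r) in Ht. rewrite Rminus_0_r in Ht. now apply Hb.
Qed.

(* At r = ln 2 the bound needed to invert 2 - e^t reads e^r - 1 <= 1, so the
   reciprocal expands on the whole disk |t| < ln 2. *)
Lemma fubini_correct (beta x : R) (m : nat) :
  2 * beta = INR m -> fubini_spec beta x (fubini beta x).
Proof.
  intros Hm. unfold fubini. apply epsilon_spec.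
  assert (H2 : 0 < ln 2) by (rewrite <- ln_1; apply ln_increasing; lra).
  destruct (expands_generating_function (ln 2) (Rpower 2 beta) m
              exp (fun t => exp (x * t))
              (fun n => / INR (fact n)) (fun n => x ^ n / INR (fact n))) as [a Ha].
  - exact H2.
  - simpl. field.
  - intros n.
    (* Partial sums of the series of e^(ln 2) = 2 with nonnegative terms; removing the leading 1
       leaves at most 1. *)
    assert (Hs : sum_f_R0 (fun k => / INR (fact k) * ln 2 ^ k) (S n) <= 2).
    { apply sum_incr.
      (* [exp] projects the limit out of [exist_exp]; unfolding it exposes the convergence statement
         that [sum_incr] takes. *)
      - pose proof (exp_ln 2) as He. unfold exp in He.
        destruct (exist_exp (ln 2)) as [l Hl]. simpl in He.
        rewrite He in Hl by lra. exact Hl.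
      - intros k. apply Rmult_le_pos; [|apply pow_le; lra].
        apply Rlt_le, Rinv_0_lt_compat, INR_fact_lt_0. }
    rewrite decomp_sum in Hs by lia.
    assert (H0 : / INR (fact 0) * ln 2 ^ 0 = 1) by (simpl; field).
    rewrite H0 in Hs. cbn [Nat.pred] in Hs.
    apply Rle_trans
      with (sum_f_R0 (fun k => / INR (fact (S k)) * ln 2 ^ S k) n); [|lra].
    right. apply sum_eq. intros k _. f_equal. apply Rabs_pos_eq.
    apply Rlt_le, Rinv_0_lt_compat, INR_fact_lt_0.
  - intros t _. apply is_exp_Reals.
  - apply expands_exp.
  - intros t Ht. apply Rabs_def2 in Ht. rewrite <- (exp_ln 2) by lra.
    apply exp_increasing. lra.
  - rewrite <- Hm in Ha. exact (egf_expansion_exists _ _ _ Ha).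
Qed.

Lemma degen_fubini_gf_lambda_0 (beta x t : R) :
  degen_fubini_gf beta x 0 t = fubini_gf beta x t.
Proof.
  unfold degen_fubini_gf, fubini_gf, degen_exp.
  destruct (Req_EM_T 0 0) as [_|H]; [|now destruct H].
  now rewrite Rmult_1_l.
Qed.

(** The two sequences are chosen from different specifications; they agree because both expand the
    same function near 0. *)
Lemma fubini_degen_fubini (beta x : R) (m n : nat) :
  2 * beta = INR m -> fubini beta x n = degen_fubini beta x 0 n.
Proof.
  intros Hm.
  assert (H2 : 0 < ln 2) by (rewrite <- ln_1; apply ln_increasing; lra).
  apply Rmult_eq_reg_r with (/ INR (fact n));
    [|apply Rinv_neq_0_compat, INR_fact_neq_0].
  apply (pseries_locally_unique (fubini_gf beta x) (degen_fubini_gf beta x 0)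
    (fun k => fubini beta x k / INR (fact k))
    (fun k => degen_fubini beta x 0 k / INR (fact k))).
  - apply (expands_locally (ln 2)); [exact H2|].
    exact (fubini_correct beta x m Hm).
  - exact (degen_fubini_correct beta x 0 m Hm).
  - apply filter_forall. intros t. symmetry. apply degen_fubini_gf_lambda_0.
Qed.

(** * Differentiation and the recurrence *)

Lemma is_derive_degen_fubini_gf (beta x lambda t : R) :
  0 < 1 + lambda * t -> degen_exp lambda 1 t < 2 ->
  is_derive (degen_fubini_gf beta (x + lambda) lambda) t
    ((x + lambda) * degen_fubini_gf beta x lambda t
     + sqrt 2 * beta * degen_fubini_gf (beta + 1 / 2) (x + 1) lambda t).
Proof.
  intros Hb Hlt.
  pose proof (is_derive_degen_exp lambda 1 t Hb) as Df.
  pose proof (is_derive_degen_exp lambda (x + lambda) t Hb) as Dg.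
  replace (x + lambda - lambda) with x in Dg by ring.
  assert (Hprod : degen_exp lambda (1 - lambda) t * degen_exp lambda (x + lambda) t
                  = degen_exp lambda (x + 1) t)
    by (rewrite <- degen_exp_plus; f_equal; ring).
  (* Raising the order by 1/2 raises the exponent 2 beta by 1, which is the extra factor produced by
     differentiating the reciprocal power. *)
  assert (Hpow : Rpower (2 - degen_exp lambda 1 t) (2 * (beta + 1 / 2))
                 = Rpower (2 - degen_exp lambda 1 t) (2 * beta) * (2 - degen_exp lambda 1 t)).
  { replace (2 * (beta + 1 / 2)) with (2 * beta + 1) by field.
    rewrite Rpower_plus, Rpower_1 by lra. reflexivity. }
  assert (H2 : Rpower 2 (beta + 1 / 2) = Rpower 2 beta * sqrt 2).
  { rewrite Rpower_plus. replace (1 / 2) with (/ 2) by field.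
    now rewrite Rpower_sqrt by lra. }
  assert (Hsq : sqrt 2 * sqrt 2 = 2) by (apply sqrt_sqrt; lra).
  unfold degen_fubini_gf. rewrite Hpow, H2, <- Hprod.
  (* As opaque functions, E_1 and E_(x + lambda) are differentiated through [Df] and [Dg] only. *)
  revert Df Dg Hlt. generalize (degen_exp lambda 1) (degen_exp lambda (x + lambda)).
  intros f g Df Dg Hlt.
  unfold Rpower at 2. auto_derive.
  - repeat split; try (now eexists; eassumption); [lra|].
    apply Rgt_not_eq, exp_pos.
  - change (fun s => f s) with f. change (fun s => g s) with g.
    rewrite (is_derive_unique _ _ _ Df), (is_derive_unique _ _ _ Dg).
    change (exp (2 * beta * ln (2 + - f t))) with (Rpower (2 - f t) (2 * beta)).
    set (P := Rpower (2 - f t) (2 * beta)).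
    assert (0 < P) by apply exp_pos.
    (* The 2 of the exponent 2 beta is split as sqrt 2 * sqrt 2: one factor stays in the
       coefficient, the other belongs to 2^(beta + 1/2). *)
    transitivity ((x + lambda) * (Rpower 2 beta / P * degen_exp lambda x t)
      + (sqrt 2 * sqrt 2) * beta * (Rpower 2 beta / (P * (2 - f t)) *
          (degen_exp lambda (1 - lambda) t * g t))).
    + rewrite Hsq. field. lra.
    + field. lra.
Qed.

Lemma degen_fubini_recurrence (beta x lambda : R) (m n : nat) :
  2 * beta = INR m ->
  degen_fubini beta (x + lambda) lambda (n + 1)
  = (x + lambda) * degen_fubini beta x lambda n
    + sqrt 2 * beta * degen_fubini (beta + 1 / 2) (x + 1) lambda n.
Proof.
  intros Hm.
  assert (Hm' : 2 * (beta + 1 / 2) = INR (S m)) by (rewrite S_INR, <- Hm; field).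
  pose proof (degen_fubini_correct beta (x + lambda) lambda m Hm) as Ha.
  pose proof (degen_fubini_correct beta x lambda m Hm) as Hb.
  pose proof (degen_fubini_correct (beta + 1 / 2) (x + 1) lambda (S m) Hm') as Hc.
  unfold degen_fubini_spec, egf_expansion_at in Ha, Hb, Hc.
  set (a := degen_fubini beta (x + lambda) lambda) in *.
  set (b := degen_fubini beta x lambda) in *.
  set (c := degen_fubini (beta + 1 / 2) (x + 1) lambda) in *.
  set (egf := fun (s : nat -> R) k => s k / INR (fact k)).
  set (d := fun k => (x + lambda) * egf b k + sqrt 2 * beta * egf c k).
  set (G := degen_fubini_gf beta (x + lambda) lambda) in *.
  (* G' is expanded twice near 0: termwise from the series of G, and through the derivative
     formula. *)
  assert (Hd : PS_derive (egf a) n = d n).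
  { apply (pseries_locally_unique (Derive G)
      (fun t => (x + lambda) * degen_fubini_gf beta x lambda t
         + sqrt 2 * beta * degen_fubini_gf (beta + 1 / 2) (x + 1) lambda t)).
    - destruct (locally_expands G (egf a) Ha) as [r [Hr Hexp]].
      apply (expands_locally r); [exact Hr|]. intros t Ht.
      replace (Derive G t) with (Derive (PSeries (egf a)) t).
      + apply is_pseries_derive. exact (expands_radius _ _ _ _ Hexp Ht).
      + apply Derive_ext_loc.
        (* The interval of radius r - |t| around t stays inside |s| < r, where G equals its
           series. *)
        assert (He : 0 < r - Rabs t) by lra.
        exists (mkposreal _ He). intros s Hs.
        change (Rabs (s - t) < r - Rabs t) in Hs.
        apply is_pseries_unique, Hexp.
        replace s with ((s - t) + t) by ring.
        eapply Rle_lt_trans; [apply Rabs_triang | lra].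
    - generalize (filter_and _ _ Hb Hc). apply filter_imp. intros t [Hbt Hct].
      now apply is_pseries_lin_comb.
    - generalize (degen_exp_near_0 lambda 1 2 ltac:(lra)). apply filter_imp.
      intros t [Hpos Hlt]. apply is_derive_unique. now apply is_derive_degen_fubini_gf. }
  unfold d, PS_derive, egf in Hd.
  rewrite fact_simpl, mult_INR in Hd.
  replace (n + 1)%nat with (S n) by lia.
  pose proof (INR_fact_neq_0 n) as Hf.
  assert (Hn : INR (S n) <> 0) by (apply not_0_INR; lia).
  apply Rmult_eq_reg_r with (/ INR (fact n)); [|now apply Rinv_neq_0_compat].
  (* Exposes the left side of [Hd]: the n + 1 from differentiation reduces (n+1)! to n!. *)
  transitivity (INR (S n) * (a (S n) / (INR (S n) * INR (fact n)))).
  - field. now split.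
  - rewrite Hd. field. exact Hf.
Qed.

Theorem theorem3p7 (alpha : nat) :
  (forall (lambda x1 x2 : R) (n : nat),
     degen_fubini (INR alpha) (x1 + x2 + lambda) lambda (n + 1)
     = (x1 + x2 + lambda) * degen_fubini (INR alpha) (x1 + x2) lambda n
       + sqrt 2 * INR alpha
         * degen_fubini (INR alpha + 1 / 2) (x1 + x2 + 1) lambda n)
  /\
  (forall (y : R) (n : nat),
     fubini (INR alpha) y (n + 1)
     = y * fubini (INR alpha) y n
       + sqrt 2 * INR alpha * fubini (INR alpha + 1 / 2) (y + 1) n).
Proof.
  assert (H2 : 2 * INR alpha = INR (2 * alpha)) by (rewrite mult_INR; reflexivity).
  assert (H3 : 2 * (INR alpha + 1 / 2) = INR (S (2 * alpha)))
    by (rewrite S_INR, <- H2; field).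
  split.
  - intros lambda x1 x2 n. exact (degen_fubini_recurrence _ _ _ _ _ H2).
  - intros y n.
    (* At lambda = 0 the shift of the argument disappears, so x = y gives the classical
       recurrence. *)
    rewrite !(fubini_degen_fubini _ _ _ _ H2), (fubini_degen_fubini _ _ _ _ H3).
    pose proof (degen_fubini_recurrence _ y 0 _ n H2) as H.
    now rewrite Rplus_0_r in H.
Qed.
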